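(* An iterator $\mathfrak i=(\mathrm{input},S,\sigma,T,\mathrm{output}):X\rightsquigarrow W$ is determined by its intension $$\mathrm{int}(\mathfrak i)=\mathrm{int}(\mathbf A_{\mathfrak i},E_{\mathfrak i}(x))=\mathfrak r(\mathbf A_{\mathfrak i},\mathrm{cf}(E_{\mathfrak i}(x))),$$ the recursive algorithm on $\mathbf A_{\mathfrak i}$ expressed by the extended tail recursive program $E_{\mathfrak i}(x)$ associated with $\mathfrak i$. That is, if $\mathfrak i:X\rightsquigarrow W$ and $\mathfrak i':X'\rightsquigarrow W'$ are iterators with $\mathrm{int}(\mathfrak i)=\mathrm{int}(\mathfrak i')$ (equality of recursors), then $X=X'$, $W=W'$ and $\mathfrak i=\mathfrak i'$.
   Context: **Iterators.** For sets $X,W$, an iterator $\mathfrak i=(\mathrm{input},S,\sigma,T,\mathrm{output}):X\rightsquigarrow W$ consists of a set $S$ of states, a function $\mathrm{input}:X\to S$, a transition function $\sigma:S\to S$, a set $T\subseteq S$ of terminal states and a function $\mathrm{output}:T\to W$. Its associated (single-sorted) structure $\mathbf A_{\mathfrak i}=(A_{\mathfrak i},X,W,S,\mathrm{input},\sigma,T,\mathrm{output})$ has universe the tagged disjoint sum $A_{\mathfrak i}=X\uplus W\uplus S=(\{0\}\times X)\cup(\{1\}\times W)\cup(\{2\}\times S)$; the functions are viewed as unary partial functions on $A_{\mathfrak i}$ via the tagging, i.e. $\mathrm{input}(0,x)=(2,\mathrm{input}(x))$, $\sigma(2,s)=(2,\sigma(s))$, $\mathrm{output}(2,s)=(1,\mathrm{output}(s))$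 for $s\in T$, each undefined elsewhere, and $T$ is the partial relation with value $\mathrm{tt}$ at $(2,s)$ if $s\in T$, value $\mathrm{ff}$ at $(2,s)$ if $s\in S\setminus T$, undefined elsewhere ($X,W,S$ also being given as relations identifying the three components). The associated extended program is $$E_{\mathfrak i}(x):\equiv q(\mathrm{input}(x))\text{ where }\{q(s)=\text{if }T(s)\text{ then }\mathrm{output}(s)\text{ else }q(\sigma(s))\}.$$ **Terms.** A signature $\Phi$ is a set of function symbols with arities and sorts in $\{\mathsf{ind},\mathsf{boole}\}$. Terms are built from $\mathrm{tt},\mathrm{ff}$, individual variables, applications of function variables $p$ (each with a sort and arity) and of symbols $\phi\in\Phi$ to terms of sort $\mathsf{ind}$, and conditionals $\mathrm{cond}(F_0,F_1,F_2)$ = ''if $F_0$ then $F_1$ else $F_2$'' ($F_0$ of sort $\mathsf{boole}$, $F_1,F_2$ of the same sort). Write $\mathsf c(F_1,\dots,F_l)$ for a term whose outermost operation $\mathsf c$ is a symbol of $\Phi$, a function variable or $\mathrm{cond}$. In a partial $\Phi$-structure $\mathbf A$ with universe $A$ (put $A_{\mathsf{ind}}=A$, $A_{\mathsf{boole}}=\{\mathrm{tt},\mathrm{ff}\}$), $\mathrm{den}((\mathbf A,\vec p),F(\vec x))$ is the (possibly undefined) value of $F$, with strict application and the usual conditional (undefined if the test is undefined; otherwise only the selected branch matters). Equality of partial values means both defined and equal or both undefined. **Programs.** A $\Phi$-program is $E\equiv E_0 \text{ where } \{p_1(\vec x_1)=E_1,\dots,p_K(\vec x_K)=E_K\}$,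 with distinct function variables $p_i$, terms $E_i$ whose function variables are among the $p_i$, lists $\vec x_i$ of $\mathrm{arity}(p_i)$ distinct individual variables including those of $E_i$, and $\mathrm{sort}(E_i)=\mathrm{sort}(p_i)$ for $i\geq 1$. An extended program $E(\vec x)$ adds a list $\vec x$ of $n$ distinct individual variables including those of $E_0$. $\mathrm{set}(E(\vec x))=\{E_0(\vec x),p_1(\vec x_1)=E_1,\dots,p_K(\vec x_K)=E_K\}$. $E\equiv_cF$ (congruence) if $F$ is obtained from $E$ by renaming bound function variables $p_i$ and bound individual variables $\vec x_i$ and permuting the body equations. **Recursors.** $\mathfrak r(\mathbf A,E(\vec x))=(\alpha_0,\dots,\alpha_K):A^n\rightsquigarrow A_s$ ($s=\mathrm{sort}(E_0)$), where $\alpha_0(\vec x,\vec p)=\mathrm{den}((\mathbf A,\vec p),E_0(\vec x))$, $\alpha_i(\vec x_i,\vec p)=\mathrm{den}((\mathbf A,\vec p),E_i(\vec x_i))$, and $p_i$ ranges over partial functions $Y_i\rightharpoonup W_i$, $Y_i=A^{\mathrm{arity}(p_i)}$, $W_i=A_{\mathrm{sort}(p_i)}$. Recursors $\alpha,\beta$ on the same input and output sets are equal if they have the same $K$ and there is a permutation $\pi$ of $\{1,\dots,K\}$ with inverse $\rho$ such that for all $i$: $Y^\beta_i=Y^\alpha_{\pi(i)}$, $W^\beta_i=W^\alpha_{\pi(i)}$, $\beta_0(x,q_1,\dots,q_K)=\alpha_0(x,q_{\rho(1)},\dots,q_{\rho(K)})$ and $\beta_i(y,q_1,\dots,q_K)=\alpha_{\pi(i)}(y,q_{\rho(1)},\dots,q_{\rho(K)})$.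 **Canonical forms and intension.** A term is immediate if it is an individual variable, a nullary function variable, or $p(u_1,\dots,u_n)$ with $p$ a function variable and the $u_i$ individual variables; irreducible if it is immediate, $\mathrm{tt}$, $\mathrm{ff}$, or $\mathsf c(I_1,\dots,I_l)$ with all $I_i$ immediate. A program is irreducible if all $E_0,\dots,E_K$ are. $E(\vec x)\Rightarrow_1F(\vec x)$ if, for some equation $p(\vec x_p)=\mathsf c(G_1,\dots,G_l)$ of $E$ with $G_j$ not immediate and a new function variable $q$ with $\mathrm{arity}(q)=\mathrm{arity}(p)$, $\mathrm{sort}(q)=\mathrm{sort}(G_j)$, $\mathrm{set}(F(\vec x))$ results from $\mathrm{set}(E(\vec x))$ by replacing that equation by $p(\vec x_p)=\mathsf c(G_1,\dots,q(\vec x_p),\dots,G_l)$ ($q(\vec x_p)$ in place $j$) and $q(\vec x_p)=G_j$; or, similarly, if $E_0\equiv\mathsf c(G_1,\dots,G_l)$ with $G_j$ not immediate is replaced by $\mathsf c(G_1,\dots,q(\vec x),\dots,G_l)$ and $q(\vec x)=G_j$ is added ($q$ new, of arity $n$ and sort $\mathrm{sort}(G_j)$). A canonical form $\mathrm{cf}(E(\vec x))$ is any irreducible extended program congruent to one obtained from $E(\vec x)$ by finitely many (possibly $0$) one-step reductions; it is unique up to congruence, and congruent extended programs define equal recursors. $\mathrm{int}(\mathbf A,E(\vec x))=\mathfrak r(\mathbf A,\mathrm{cf}(E(\vec x)))$. *)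

(* Defs.v *)
From HB Require Import structures.
From Stdlib Require List Relation_Operators.
From mathcomp Require Import all_boot.
From mathcomp Require Import all_classical.

Set Implicit Arguments.
Unset Strict Implicit.
Unset Printing Implicit Defensive.

Local Open Scope classical_set_scope.

(* Sets are subsets (type [set T]) of an ambient type, so that equality of sets
   (in particular of universes of structures) is extensional equality.
   A partial function is an option-valued function on the ambient type which is
   [None] outside of its domain; these are in bijection with functional graphs,
   so Leibniz equality of such functions is equality of partial functions. *)

Definition is_pfun {T T' : Type} (D : set T) (C : set T') (f : T -> option T')
  : Prop := forall x y, f x = Some y -> D x /\ C y.

Definition is_fun {T T' : Type} (D : set T) (C : set T') (f : T -> option T')
  : Prop := is_pfun D C f /\ forall x, D x -> exists y, f x = Some y.

Variant sort := Ind | Boole.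

Definition bool_of_sort (s : sort) : bool := if s is Boole then true else false.
Definition sort_of_bool (b : bool) : sort := if b then Boole else Ind.
Lemma bool_of_sortK : cancel bool_of_sort sort_of_bool.
Proof. by case. Qed.
HB.instance Definition _ := Equality.copy sort (can_type bool_of_sortK).

Record signature := Signature {
  symbol : Type;
  sarity : symbol -> nat;
  ssort : symbol -> sort }.

(* A function variable is a name together with its sort and its arity. *)
Definition fvar : Type := (nat * sort * nat)%type.
Definition fsort (p : fvar) : sort := p.1.2.
Definition farity (p : fvar) : nat := p.2.

Section Syntax.
Variable Phi : signature.

Variant op :=
  | OFun of fvar
  | OSym of symbol Phi
  | OCond.

Inductive term :=
  | Tt
  | Ff
  | Var of nat
  | App of op & seq term.

Fixpoint tsort (t : term) : sort :=
  match t with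
  | Tt | Ff => Boole
  | Var _ => Ind
  | App (OFun p) _ => fsort p
  | App (OSym f) _ => ssort f
  | App OCond Gs => if Gs is [:: _; G1; _] then tsort G1 else Ind
  end.

Fixpoint wf_term (t : term) : bool :=
  match t with
  | App c Gs =>
      all wf_term Gs &&
      match c with
      | OFun p => (size Gs == farity p) && all (fun G => tsort G == Ind) Gs
      | OSym f => (size Gs == sarity f) && all (fun G => tsort G == Ind) Gs
      | OCond =>
          if Gs is [:: G0; G1; G2]
          then (tsort G0 == Boole) && (tsort G1 == tsort G2) else false
      end
  | _ => true
  end.

Fixpoint ivars (t : term) : seq nat :=
  match t with
  | Tt | Ff => [::]
  | Var x => [:: x]
  | App _ Gs => flatten (map ivars Gs)
  end.

Fixpoint fvars (t : term) : seq fvar :=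
  match t with
  | App c Gs =>
      (if c is OFun p then [:: p] else [::]) ++ flatten (map fvars Gs)
  | _ => [::]
  end.

(* [Equation p xs t] is the equation p(xs) = t. *)
Record equation := Equation {
  lhs : fvar;
  params : seq nat;
  rhs : term }.

Record raw_program := RawProgram {
  inputs : seq nat;
  head : term;
  body : seq equation }.

Definition bound_fvars (E : raw_program) : seq fvar := map lhs (body E).

Definition wf_equation (ps : seq fvar) (e : equation) : bool :=
  [&& uniq (params e), size (params e) == farity (lhs e), wf_term (rhs e),
      tsort (rhs e) == fsort (lhs e),
      all (mem (params e)) (ivars (rhs e)) & all (mem ps) (fvars (rhs e))].

Definition wf_program (E : raw_program) : bool :=
  [&& uniq (bound_fvars E), all (wf_equation (bound_fvars E)) (body E),
      uniq (inputs E), wf_term (head E),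
      all (mem (inputs E)) (ivars (head E)) &
      all (mem (bound_fvars E)) (fvars (head E))].

Record ext_program := ExtProgram {
  raw :> raw_program;
  raw_wf : wf_program raw }.

Definition eqn (E : raw_program) (i : 'I_(size (body E))) : equation :=
  tnth (in_tuple (body E)) i.

(* set(E(x)): its members are E_0(x) and the equations of the body. *)
Variant item :=
  | IHead of seq nat & term
  | IEqn of equation.

Definition prog_set (E : raw_program) : set item := fun it =>
  match it with
  | IHead xs t => xs = inputs E /\ t = head E
  | IEqn e => List.In e (body E)
  end.

Definition is_var (t : term) : bool := if t is Var _ then true else false.

Definition immediate (t : term) : bool :=
  match t with
  | Var _ => true
  | App (OFun _) us => all is_var us
  | _ => false
  end.

Definition irreducible_term (t : term) : bool :=
  immediate t ||
  match t with
  | Tt | Ff => true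
  | App _ Is => all immediate Is
  | Var _ => false
  end.

Definition irreducible (E : raw_program) : bool :=
  irreducible_term (head E) &&
  all (fun e => irreducible_term (rhs e)) (body E).

Definition call (q : fvar) (xs : seq nat) : term := App (OFun q) (map Var xs).

Variant red1 (E F : ext_program) : Prop :=
  | Red1Body (p : fvar) (xs : seq nat) (c : op) (Gs : seq term) (j : nat)
      (q : fvar) of
      List.In (Equation p xs (App c Gs)) (body E) &
      j < size Gs & ~~ immediate (nth Tt Gs j) &
      q \notin bound_fvars E &
      farity q = farity p & fsort q = tsort (nth Tt Gs j) &
      prog_set F =
        (prog_set E `\ IEqn (Equation p xs (App c Gs))) `|`
        [set IEqn (Equation p xs (App c (set_nth Tt Gs j (call q xs))));
             IEqn (Equation q xs (nth Tt Gs j))]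
  | Red1Head (c : op) (Gs : seq term) (j : nat) (q : fvar) of
      head E = App c Gs &
      j < size Gs & ~~ immediate (nth Tt Gs j) &
      q \notin bound_fvars E &
      farity q = size (inputs E) & fsort q = tsort (nth Tt Gs j) &
      prog_set F =
        (prog_set E `\ IHead (inputs E) (App c Gs)) `|`
        [set IHead (inputs E) (App c (set_nth Tt Gs j (call q (inputs E))));
             IEqn (Equation q (inputs E) (nth Tt Gs j))].

Fixpoint rename (tau : fvar -> fvar) (nu : nat -> nat) (t : term) : term :=
  match t with
  | Tt => Tt
  | Ff => Ff
  | Var x => Var (nu x)
  | App c Gs =>
      App (if c is OFun p then OFun (tau p) else c) (map (rename tau nu) Gs)
  end.

Definition rename_eqn (tau : fvar -> fvar) (nu : nat -> nat) (e : equation)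
  : equation :=
  Equation (tau (lhs e)) (map nu (params e)) (rename tau nu (rhs e)).

(* The inputs of an extended program are free in it, hence not renamed; the
   individual variables are renamed separately in each equation. *)
Definition congruent (E F : ext_program) : Prop :=
  exists (tau : fvar -> fvar)
         (pi : 'I_(size (body F)) -> 'I_(size (body E))),
  [/\ {in bound_fvars E &, injective tau},
      forall p, fsort (tau p) = fsort p /\ farity (tau p) = farity p,
      size (body F) = size (body E) /\ bijective pi,
      inputs F = inputs E /\ head F = rename tau id (head E) &
      forall i, exists2 nu : nat -> nat,
        {in params (eqn (pi i)) &, injective nu} &
        eqn i = rename_eqn tau nu (eqn (pi i))].

Definition is_cf (E F : ext_program) : Prop :=
  irreducible F /\
  exists2 G, Relation_Operators.clos_refl_trans ext_program red1 E G & congruent G F.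

End Syntax.

Arguments OCond {Phi}.
Arguments Tt {Phi}.
Arguments Ff {Phi}.
Arguments Var {Phi}.

Variant value (V : Type) := VInd of V | VBoole of bool.
Arguments VBoole {V}.

(* A^n, as a set of sequences. *)
Definition cart {V : Type} (A : set V) (n : nat) : set (seq V) :=
  [set vs | size vs = n /\ forall v, List.In v vs -> A v].

Definition sort_set {V : Type} (A : set V) (s : sort) : set (value V) :=
  if s is Boole then range VBoole else [set VInd v | v in A].

Record pstructure (Phi : signature) (V : Type) := PStructure {
  universe : set V;
  interp : symbol Phi -> seq V -> option (value V);
  interp_pfun : forall f : symbol Phi,
    is_pfun (cart universe (sarity f)) (sort_set universe (ssort f)) (interp f) }.

Section Denotation.
Variables (Phi : signature) (V : Type).

Fixpoint ind_args (os : seq (option (value V))) : option (seq V) :=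
  match os with
  | [::] => Some [::]
  | Some (VInd v) :: os' => omap (cons v) (ind_args os')
  | _ => None
  end.

Definition den_op (A : pstructure Phi V) (env : fvar -> seq V -> option (value V))
    (c : op Phi) (os : seq (option (value V))) : option (value V) :=
  match c with
  | OFun p => obind (env p) (ind_args os)
  | OSym f => obind (interp A f) (ind_args os)
  | OCond =>
      match os with
      | [:: Some (VBoole b); o1; o2] => if b then o1 else o2
      | _ => None
      end
  end.

Fixpoint den (A : pstructure Phi V) (env : fvar -> seq V -> option (value V))
    (rho : nat -> option V) (t : term Phi) : option (value V) :=
  match t with
  | Tt => Some (VBoole true)
  | Ff => Some (VBoole false)
  | Var x => omap (@VInd V) (rho x)
  | App c Gs => den_op A env c (map (den A env rho) Gs)
  end.

End Denotation.

(* The parts are compared (see [recursor_eq]) only on arguments in the given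
   sets, their values elsewhere being irrelevant. *)
Record recursor (Y W : Type) := Recursor {
  rK : nat;
  rinput : set Y;
  routput : set W;
  rY : 'I_rK -> set Y;
  rW : 'I_rK -> set W;
  rhead : Y -> ('I_rK -> Y -> option W) -> option W;
  rpart : 'I_rK -> Y -> ('I_rK -> Y -> option W) -> option W }.

Definition recursor_eq {Y W : Type} (a b : recursor Y W) : Prop :=
  [/\ rinput a = rinput b, routput a = routput b, rK a = rK b &
  exists (pi : 'I_(rK b) -> 'I_(rK a)) (rho : 'I_(rK a) -> 'I_(rK b)),
  [/\ cancel pi rho /\ cancel rho pi,
      forall i, rY i = rY (pi i) /\ rW i = rW (pi i),
      forall (x : Y) (q : 'I_(rK b) -> Y -> option W),
        rinput b x -> (forall j, is_pfun (rY j) (rW j) (q j)) ->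
        rhead x q = rhead x (fun k => q (rho k)) &
      forall (i : 'I_(rK b)) (y : Y) (q : 'I_(rK b) -> Y -> option W),
        rY i y -> (forall j, is_pfun (rY j) (rW j) (q j)) ->
        rpart i y q = rpart (pi i) y (fun k => q (rho k))]].

Section ProgramRecursor.
Variables (Phi : signature) (V : Type) (A : pstructure Phi V).

Definition fenv (E : ext_program Phi)
    (p : 'I_(size (body E)) -> seq V -> option (value V))
    (f : fvar) : seq V -> option (value V) :=
  if insub (index f (bound_fvars E)) is Some i then p i else fun _ => None.

Definition ienv (xs : seq nat) (vs : seq V) (x : nat) : option V :=
  onth vs (index x xs).

Definition recursor_of (E : ext_program Phi) : recursor (seq V) (value V) :=
  @Recursor (seq V) (value V) (size (body E))
    (cart (universe A) (size (inputs E)))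
    (sort_set (universe A) (tsort (head E)))
    (fun i => cart (universe A) (farity (lhs (eqn i))))
    (fun i => sort_set (universe A) (fsort (lhs (eqn i))))
    (fun xs p => den A (fenv p) (ienv (inputs E) xs) (head E))
    (fun i ys p => den A (fenv p) (ienv (params (eqn i)) ys) (rhs (eqn i))).

(* cf(E) is unique only up to congruence, so int(A, E) is given as the relation
   which holds of r(A, F) for all the canonical forms F of E. *)
Definition is_int (E : ext_program Phi) (r : recursor (seq V) (value V)) : Prop :=
  exists2 F, is_cf E F & r = recursor_of F.

End ProgramRecursor.

Record iterator (U : Type) := Iterator {
  iX : set U;
  iW : set U;
  iS : set U;
  input : U -> option U;
  sigma : U -> option U;
  iT : set U;
  output : U -> option U;
  input_fun : is_fun iX iS input;
  sigma_fun : is_fun iS iS sigma;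
  iT_sub : iT `<=` iS;
  output_fun : is_fun iT iW output }.

Variant iter_symbol := SyX | SyW | SyS | SyInput | SySigma | SyT | SyOutput.

Definition iter_sig : signature :=
  @Signature iter_symbol (fun=> 1) (fun f =>
    match f with
    | SyInput | SySigma | SyOutput => Ind
    | SyX | SyW | SyS | SyT => Boole
    end).

Section IteratorStructure.
Variables (U : Type) (i : iterator U).

Definition iter_universe : set (nat * U) :=
  ([set 0] `*` iX i) `|` ([set 1] `*` iW i) `|` ([set 2] `*` iS i).

Definition iter_interp (f : iter_symbol) (vs : seq (nat * U))
  : option (value (nat * U)) :=
  match f, vs with
  | SyX, [:: v] =>
      if `[< iter_universe v >] then Some (VBoole (v.1 == 0)) else None
  | SyW, [:: v] =>
      if `[< iter_universe v >] then Some (VBoole (v.1 == 1)) else None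
  | SyS, [:: v] =>
      if `[< iter_universe v >] then Some (VBoole (v.1 == 2)) else None
  | SyInput, [:: v] =>
      if v is (0, x) then omap (fun s => VInd (2, s)) (input i x) else None
  | SySigma, [:: v] =>
      if v is (2, s) then omap (fun s' => VInd (2, s')) (sigma i s) else None
  | SyT, [:: v] =>
      if v is (2, s)
      then if `[< iS i s >] then Some (VBoole `[< iT i s >]) else None
      else None
  | SyOutput, [:: v] =>
      if v is (2, s) then omap (fun w => VInd (1, w)) (output i s) else None
  | _, _ => None
  end.

Lemma iter_interp_pfun (f : symbol iter_sig) :
  is_pfun (cart iter_universe (sarity f)) (sort_set iter_universe (ssort f))
    (iter_interp f).
Proof.
have c1 v : iter_universe v -> cart iter_universe 1 [:: v].
  by move=> Av; split=> // w [<-|[]].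
case: f => -[|[k u] [|? ?]] y //=.
- by case: asboolP => // Au [<-]; split; [exact: c1|exists (k == 0)].
- by case: asboolP => // Au [<-]; split; [exact: c1|exists (k == 1)].
- by case: asboolP => // Au [<-]; split; [exact: c1|exists (k == 2)].
- case: k => [|k] //; case E: (input i u) => [s|] //= [<-].
  have [Xu Ss] := (input_fun i).1 _ _ E; split; first by apply: c1; left; left.
  by exists (2, s) => //; right.
- case: k => [|[|[|k]]] //; case E: (sigma i u) => [s|] //= [<-].
  have [Su Ss] := (sigma_fun i).1 _ _ E; split; first by apply: c1; right.
  by exists (2, s) => //; right.
- case: k => [|[|[|k]]] //; case: asboolP => // Su [<-].
  by split; [apply: c1; right|exists `[< iT i u >]].
- case: k => [|[|[|k]]] //; case E: (output i u) => [w|] //= [<-].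
  have [Tu Ww] := (output_fun i).1 _ _ E; split.
    by apply: c1; right; split=> //; exact: (@iT_sub _ i).
  by exists (1, w) => //; left; right.
Qed.

Definition iter_structure : pstructure iter_sig (nat * U) :=
  @PStructure iter_sig (nat * U) iter_universe iter_interp iter_interp_pfun.

End IteratorStructure.

Section IteratorProgram.

Let x : nat := 0.
Let s : nat := 1.
Let q : fvar := (0, Ind, 1).
Let sym (f : iter_symbol) (t : term iter_sig) : term iter_sig :=
  App (OSym (f : symbol iter_sig)) [:: t].
Let qapp (t : term iter_sig) : term iter_sig := App (OFun _ q) [:: t].

Definition iter_raw_program : raw_program iter_sig :=
  RawProgram [:: x] (qapp (sym SyInput (Var x)))
    [:: Equation q [:: s]
          (App OCond [:: sym SyT (Var s);
                         sym SyOutput (Var s);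
                         qapp (sym SySigma (Var s))])].

Lemma iter_raw_program_wf : wf_program iter_raw_program.
Proof. by []. Qed.

Definition iter_program : ext_program iter_sig :=
  ExtProgram iter_raw_program_wf.

End IteratorProgram.

Definition iter_is_int {U : Type} (i : iterator U)
    (r : recursor (seq (nat * U)) (value (nat * U))) : Prop :=
  is_int (iter_structure i) iter_program r.

(* Main.v *)
(** Evaluate every part of the recursor at the everywhere undefined functions.
    In a canonical form of the program of an iterator, the only parts which are
    then somewhere defined are those of the equations [p(s) = f(s)], where [f]
    is one of input, sigma, T and output.  Hence the union of the graphs so
    obtained, which does not depend on the order of the parts, is the union of
    the graphs of these four functions, and it can be decomposed again because
    the tags of the argument and of the value tell which one they come from.
    The sets X, W and S are read off the universe of the structure. *)
From Stdlib Require List Relation_Operators.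
From mathcomp Require Import all_boot.
From mathcomp Require Import all_classical.
Require Import Defs.

Local Open Scope classical_set_scope.

(** * Lists and graphs of partial functions *)

Lemma InP {T : Type} (x : T) (s : seq T) :
  List.In x s <-> exists i : 'I_(size s), x = tnth (in_tuple s) i.
Proof.
split=> [|[i ->]].
  elim: s => //= y s IHs [<-|/IHs[i ->]]; first by exists ord0.
  by exists (lift ord0 i); rewrite !(tnth_nth y).
rewrite (tnth_nth (tnth (in_tuple s) i)) /=.
move: (tnth _ _) => x0; case: i => j /=.
elim: s j => //= y s IHs [_|j /IHs]; [by left | by right].
Qed.

Lemma all_In {T : Type} (a : pred T) (s : seq T) x :
  all a s -> List.In x s -> a x.
Proof. by elim: s => //= y s IHs /andP[ay /IHs h] [<-|/h]. Qed.

Lemma option_ext {T T' : Type} (f g : T -> option T') :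
  (forall x y, f x = Some y <-> g x = Some y) -> f = g.
Proof.
move=> fg; apply/funext => x; case E: (g x) => [y|]; first exact/fg.
by case E': (f x) => [y|] //; move/fg: E'; rewrite E.
Qed.

(** * Flat terms and occurrences of symbols *)

Section Terms.
Context {Phi : signature}.
Implicit Types (t : term Phi) (Gs : seq (term Phi)).

(** The generated induction principle gives no hypothesis on the arguments of [App], which are
    nested in a list; the inner [fix] supplies it. *)
Fixpoint term_nested_ind (P : term Phi -> Prop) (PTt : P Tt) (PFf : P Ff)
    (PVar : forall x, P (Var x))
    (PApp : forall c Gs, List.Forall P Gs -> P (App c Gs)) t : P t :=
  match t with
  | Tt => PTt
  | Ff => PFf
  | Var x => PVar x
  | App c Gs => PApp c Gs
      ((fix all_args Gs : List.Forall P Gs :=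
          match Gs with
          | [::] => List.Forall_nil _
          | G :: Gs' => List.Forall_cons _
              (term_nested_ind P PTt PFf PVar PApp G) (all_args Gs')
          end) Gs)
  end.

(* The invariant of reduction which leaves [p(s) = f(s)] as the only possible
   shape of an irreducible equation containing the symbol [f]. *)
Fixpoint flat t : bool :=
  match t with
  | Tt | Ff => false
  | Var _ => true
  | App c Gs => all flat Gs && (if c is OSym _ then all (@is_var Phi) Gs else true)
  end.

(** [symbol Phi] is a bare type without decidable equality, hence the classical test. *)
Fixpoint occurs (f : symbol Phi) t : bool :=
  match t with
  | App c Gs => (if c is OSym g then `[< g = f >] else false)
                || has (occurs f) Gs
  | _ => false
  end.

Lemma is_var_rename tau nu t : is_var (rename tau nu t) = is_var t.
Proof. by case: t. Qed.

Lemma flat_rename tau nu t : flat (rename tau nu t) = flat t.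
Proof.
elim/term_nested_ind: t => // c Gs IH /=; rewrite !all_map; congr (_ && _).
  by elim: IH => //= G Gs' -> _ ->.
by case: c => // f; apply: eq_all => G; exact: is_var_rename.
Qed.

Lemma occurs_rename f tau nu t : occurs f (rename tau nu t) = occurs f t.
Proof.
elim/term_nested_ind: t => // c Gs IH /=; rewrite !has_map; congr (_ || _).
  by case: c.
by elim: IH => //= G Gs' -> _ ->.
Qed.

Lemma flat_call q xs : flat (call Phi q xs).
Proof. by rewrite /= all_map andbT; apply/allP. Qed.

Lemma occurs_call f q xs : occurs f (call Phi q xs) = false.
Proof. by rewrite /= has_map; apply/hasP => -[]. Qed.

Lemma occurs_immediate f t : immediate t -> occurs f t = false.
Proof. by case: t => // -[p|//|//] Gs /=; elim: Gs => //= -[]. Qed.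

(** In a flat term the arguments of a symbol are variables, which are immediate. So a non-immediate
    argument is never taken out from under a symbol, and the applications [f(s)] stay intact. *)
Lemma flat_set_nth c Gs j G : j < size Gs -> ~~ immediate (nth Tt Gs j) ->
  flat (App c Gs) -> flat G -> flat (App c (set_nth Tt Gs j G)).
Proof.
move=> jGs imm /= /andP[fl cvar] flG; rewrite set_nthE jGs.
move: fl cvar imm; rewrite -{1 2}(cat_take_drop j Gs) (drop_nth Tt jGs).
rewrite !all_cat /= => /and3P[-> _ ->]; rewrite flG; case: c => //= f.
by case/and3P => _; case: (nth _ _ _).
Qed.

(** [G] stands for the call of the new function variable: it brings no symbol, so those of the old
    term are shared between the shortened term and the extracted argument. *)
Lemma occurs_split f c Gs j G : j < size Gs -> occurs f G = false ->
  occurs f (App c Gs) =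
  occurs f (App c (set_nth Tt Gs j G)) || occurs f (nth Tt Gs j).
Proof.
move=> jGs oG /=; rewrite set_nthE jGs.
rewrite -{1}(cat_take_drop j Gs) (drop_nth Tt jGs).
rewrite !has_cat /= oG; case: (has _ (take _ _)); rewrite ?orbT //=.
by rewrite -orbA [X in _ = _ || X]orbC.
Qed.

End Terms.

(** * Invariance under reduction and congruence *)

Section Invariant.
Context {Phi : signature}.
Implicit Types (E F : ext_program Phi) (P : set (item Phi)).

Definition item_term (it : item Phi) : term Phi :=
  match it with IHead _ t => t | IEqn e => rhs e end.

(** A head that is a call contains no symbol once it is irreducible. Equations [p(s) = s] are
    excluded because they would be defined even at undefined functions. *)
Definition flat_item (it : item Phi) : Prop :=
  match it with
  | IHead xs t =>
      [/\ size xs = 1, flat t & if t is App (OFun _) _ then true else false]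
  | IEqn e => [/\ size (params e) = 1, flat (rhs e) & ~~ is_var (rhs e)]
  end.

Definition flat_program P : Prop := forall it, P it -> flat_item it.

Definition symbols P : set (symbol Phi) :=
  [set f | exists2 it, P it & occurs f (item_term it)].

(** Common core of the two reduction rules: both trade one item for two which together have the same
    symbols. *)
Lemma replace_item P it it1 it2 : P it ->
  (flat_item it -> flat_item it1 /\ flat_item it2) ->
  (forall f, occurs f (item_term it) =
             occurs f (item_term it1) || occurs f (item_term it2)) ->
  let Q := (P `\ it) `|` [set it1; it2] in
  flat_program P -> flat_program Q /\ symbols Q = symbols P.
Proof.
move=> Pit fl occ Q flP; have [fl1 fl2] := fl (flP _ Pit); split.
  by move=> jt [[/flP]|[->|->]].
apply/seteqP; split=> f [jt].
  case=> [[Pjt _] fj|[->|->] fj]; first by exists jt.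
    by exists it; rewrite ?occ ?fj.
  by exists it; rewrite ?occ ?fj ?orbT.
move=> Pjt fj; have [jtit|jtit] := pselect (jt = it).
  move: fj; rewrite jtit occ => /orP[] fj; [exists it1 | exists it2] => //.
    by right; left.
  by right; right.
by exists jt => //; left.
Qed.

Lemma red1_invariant E F : red1 E F -> flat_program (prog_set E) ->
  flat_program (prog_set F) /\ symbols (prog_set F) = symbols (prog_set E).
Proof.
case=> [p xs c Gs j q inE jGs imm _ _ _ ->|c Gs j q hE jGs imm _ _ _ ->].
- apply: replace_item => //.
    move=> [/= sz fl _]; split; split=> //.
    + exact: flat_set_nth (flat_call _ _).
    + by case/andP: fl => /(all_nthP Tt)/(_ _ jGs).
    (* A variable is immediate, so the right-hand side of the new equation is not one. *)
    + by case: (nth _ _ _) imm.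
  by move=> f; apply: occurs_split => //; exact: occurs_call.
- apply: replace_item => //.
    move=> [/= sz fl ic]; split; split=> //.
    + exact: flat_set_nth (flat_call _ _).
    + by case/andP: fl => /(all_nthP Tt)/(_ _ jGs).
    + by case: (nth _ _ _) imm.
  by move=> f; apply: occurs_split => //; exact: occurs_call.
Qed.

Lemma reds_invariant E F :
  Relation_Operators.clos_refl_trans _ (@red1 Phi) E F ->
  flat_program (prog_set E) ->
  flat_program (prog_set F) /\ symbols (prog_set F) = symbols (prog_set E).
Proof.
elim=> [{}E {}F /red1_invariant|//|{}E G {}F _ IH1 _ IH2 flE] //.
by have [/IH2[? ->] <-] := IH1 flE.
Qed.

(** Renaming touches variables only, and each equation of either program has a counterpart in the
    other through [pi]. *)
Lemma congruent_invariant E F : congruent E F -> flat_program (prog_set E) ->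
  flat_program (prog_set F) /\ symbols (prog_set F) = symbols (prog_set E).
Proof.
move=> [tau [pi [_ _ [_ [pi' _ piK]] [inF hF] eqnF]]] flE.
have flhead := flE (IHead (inputs E) (head E)) (conj erefl erefl).
split=> [[xs t [-> ->]|e /InP[i ->]]|].
- case: flhead; rewrite inF hF /= flat_rename => ? ? hd; split=> //.
  by case: (head E) hd => // -[].
- rewrite -/(eqn i); have [nu _ ->] := eqnF i => /=.
  rewrite size_map flat_rename is_var_rename.
  by apply: (flE (IEqn _)); apply/InP; exists (pi i).
apply/seteqP; split=> f [[xs t [-> ->]|e /InP[i ->]]] /=.
- rewrite hF occurs_rename => fh.
  by exists (IHead (inputs E) (head E)).
- rewrite -/(eqn i); have [nu _ ->] := eqnF i => /=.
  rewrite occurs_rename => fe; exists (IEqn (eqn (pi i))) => //.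
  by apply/InP; exists (pi i).
- move=> fh; exists (IHead (inputs F) (head F)) => //=.
  by rewrite hF occurs_rename.
- move=> fe; exists (IEqn (eqn (pi' i))); first by apply/InP; exists (pi' i).
  have [nu _ ->] := eqnF (pi' i) => /=; rewrite occurs_rename piK.
  exact: fe.
Qed.

Lemma cf_invariant E F : is_cf E F -> flat_program (prog_set E) ->
  [/\ irreducible F, flat_program (prog_set F) &
      symbols (prog_set F) = symbols (prog_set E)].
Proof.
move=> [irrF [G /reds_invariant EG /congruent_invariant GF]] /EG[/GF[? ->] ->].
by [].
Qed.

End Invariant.

(** * Evaluation at the everywhere undefined functions *)

Section UndefinedGraph.

(** The condition [rY k y] is there because equality of recursors compares the parts only on
    arguments in their sets. *)
Definition undef_graph {Y W : Type} (r : recursor Y W) (y : Y) (w : W) : Prop :=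
  exists2 k, rY k y & rpart (r := r) k y (fun _ _ => None) = Some w.

(** The everywhere undefined tuple is admissible and unchanged by permuting its entries, so the
    equality of parts can be applied to it. *)
Lemma recursor_eq_undef_graph {Y W : Type} (a b : recursor Y W) y w :
  recursor_eq a b -> undef_graph a y w <-> undef_graph b y w.
Proof.
move=> [_ _ _ [pi [rho [[piK rhoK] YW _ part]]]].
have nopf D C : is_pfun D C (fun=> None : option W) by [].
split=> -[k Yk pk].
  exists (rho k); first by rewrite (YW _).1 rhoK.
  by rewrite part ?rhoK // (YW _).1 rhoK.
by exists (pi k); rewrite -?(YW _).1 // -(part k y (fun _ _ => None)).
Qed.

Context {Phi : signature} {V : Type} (A : pstructure Phi V).
Hypothesis unary : forall f : symbol Phi, sarity f = 1.

Lemma fenv_undef (F : ext_program Phi) f vs :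
  fenv (V := V) (E := F) (fun _ _ => None) f vs = None.
Proof. by rewrite /fenv; case: insub. Qed.

(** By cases on the outermost operation. A call is undefined. So is a conditional: its test is
    immediate and of sort boole, hence a call. A symbol is applied to the only parameter, whose
    value is [v]. *)
Lemma den_undef (F : ext_program Phi) (e : equation Phi) v w :
  let env := fenv (V := V) (E := F) (fun _ _ => None) in
  wf_equation (bound_fvars F) e -> irreducible_term (rhs e) ->
  flat_item (IEqn e) ->
  den A env (ienv (params e) [:: v]) (rhs e) = Some w <->
  exists2 f, interp A f [:: v] = Some w & occurs f (rhs e).
Proof.
move=> env /and5P[_ _ wft _ /andP[iv _]] irr [sz fl nv].
case: (rhs e) wft iv irr fl nv => // c Gs wft iv irr fl _.
(* Symbols can occur only at the root: the arguments are immediate, or variables by flatness when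
   [c] is a symbol. *)
have noargs : (if c is OSym _ then true else all (@immediate Phi) Gs) ->
    forall f, has (occurs f) Gs = false.
  move=> {wft irr iv} imm f; case: c imm fl => [p|g|] imm /andP[_ cvar].
  - by elim: Gs imm {cvar} => //= G Gs' IH /andP[/occurs_immediate-> /IH].
  - by elim: Gs cvar {imm} => //= -[] //.
  - by elim: Gs imm {cvar} => //= G Gs IH /andP[/occurs_immediate-> /IH].
case: c wft iv irr fl noargs => [p|g|] wft iv irr fl noargs.
- have imm : all (@immediate Phi) Gs.
    case/orP: irr => //= irr.
    by elim: Gs irr {wft iv fl noargs} => //= -[] // x Gs IH /IH.
  split=> [/=|[f _ /=]]; last by rewrite noargs.
  by case: ind_args => //= us; rewrite /env fenv_undef.
- move: wft fl iv => /= /and3P[_ + _] /andP[_]; rewrite unary.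
  case: Gs {irr noargs} => [|[||x|? ?] [|? ?]] //= _ _.
  (* The argument must be the sole parameter, so it is looked up at index 0 of [[:: v]]. *)
  case: (params e) sz => [|y []] //= _; rewrite inE andbT => /eqP->.
  rewrite /ienv /= eqxx /=; split=> [fw|[f]].
    by exists g; rewrite ?orbF ?asboolT.
  by rewrite orbF => fw /asboolP->.
- have imm : all (@immediate Phi) Gs by [].
  split=> [|[f _ /=]]; last by rewrite noargs.
  move: wft imm => /= /andP[_].
  case: Gs {iv irr fl noargs} => [|G0 [|G1 [|G2 [|? ?]]]] //= /andP[bo _].
  move=> /and4P[]; case: G0 bo => // -[p|//|//] us _ _ _ _ _ /=.
  by case: ind_args => //= vs; rewrite /env fenv_undef.
Qed.

Lemma cf_undef_graph (F : ext_program Phi) y w :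
  irreducible F -> flat_program (prog_set F) ->
  undef_graph (recursor_of A F) y w <->
  exists2 f, symbols (prog_set F) f & interp A f y = Some w.
Proof.
move=> /andP[irrh irrb] flF; have /and5P[_ wfb _ _ _] := raw_wf F.
have eqnE k : List.In (eqn (E := F) k) (body F) by apply/InP; exists k.
have fle k : flat_item (IEqn (eqn (E := F) k)) by exact: flF (IEqn _) (eqnE k).
have denE (k : 'I_(size (body F))) v := @den_undef F (eqn k) v w (all_In _ _ _ wfb (eqnE k))
  (all_In _ _ _ irrb (eqnE k)) (fle k).
have arity1 k : farity (lhs (eqn (E := F) k)) = 1.
  by have /and5P[_ /eqP<- _ _ _] := all_In _ _ _ wfb (eqnE k); case: (fle k).
split=> [[k /= Yk]|[f [it Fit fit] fw]].
  move: Yk; rewrite arity1 => -[]; case: y => [|v []] //= _ _.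
  by move/denE => [f fw fo]; exists f => //; exists (IEqn (eqn k)).
(* A defined interpretation confines [y] to sequences of length one over the universe, the domain of
   every part. *)
have [cy _] := interp_pfun fw; rewrite unary in cy.
case: it Fit fit => [xs t [_ ->]|e /InP[k ->]] fo /=.
  (* The head is not among the parts, so it must contribute no symbol: being an irreducible call, it
     is immediate or has immediate arguments. *)
  have [_ _] := flF (IHead (inputs F) (head F)) (conj erefl erefl).
  case: (head F) irrh fo => // -[p|//|//] Gs irr fo _.
  case/orP: irr => [imm|/= imm]; first by rewrite (occurs_immediate f) in fo.
  by elim: Gs imm fo => //= G Gs IH /andP[/occurs_immediate->].
exists k => /=; first by rewrite arity1.
by case: cy; case: y fw => [|v []] //= fw _ _; apply/denE; exists f.
Qed.

End UndefinedGraph.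

(** * Recovering an iterator from its intension *)

Section IteratorIntension.
Context {U : Type}.
Implicit Type i : iterator U.

Lemma iter_program_flat : flat_program (prog_set iter_program).
Proof. by move=> [xs t [-> ->]|e [<-|]]. Qed.

Lemma iter_program_symbols :
  symbols (prog_set iter_program) = [set SyInput; SySigma; SyT; SyOutput].
Proof.
apply/seteqP; split=> f.
  case=> [[xs t [_ ->]|e [<-|//]]] /=; rewrite !orbF.
    by move/asboolP<-; left; left; left.
  by case/or3P => /asboolP<-; [left; right|right|left; left; right].
case=> [[[->|->]|->]|->].
- exists (IHead (inputs iter_program) (head iter_program)) => //=.
  by rewrite asboolT.
- exists (IEqn (eqn (E := iter_program) ord0)); first by left.
  by rewrite /= (asboolT (erefl SySigma)) !orbT.
- exists (IEqn (eqn (E := iter_program) ord0)); first by left.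
  by rewrite /= (asboolT (erefl SyT)).
- exists (IEqn (eqn (E := iter_program) ord0)); first by left.
  by rewrite /= (asboolT (erefl SyOutput)) !orbT.
Qed.

(** Flatness of the head item ensures that a canonical form still has exactly one input. *)
Lemma iter_int_input i r :
  iter_is_int i r -> rinput r = cart (iter_universe i) 1.
Proof.
move=> [F /cf_invariant/(_ iter_program_flat)[_ flF _] ->] /=.
by have [->] := flF (IHead (inputs F) (head F)) (conj erefl erefl).
Qed.

Lemma iter_int_undef_graph i r y w : iter_is_int i r ->
  undef_graph r y w <->
  exists2 f, [set SyInput; SySigma; SyT; SyOutput] f & iter_interp i f y = Some w.
Proof.
move=> [F /cf_invariant/(_ iter_program_flat)[irrF flF symF] ->].
by rewrite -iter_program_symbols -symF; exact: cf_undef_graph.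
Qed.

(** Among the four functions, only [input] is defined at tag 0. *)
Lemma input_undef_graph i r x s : iter_is_int i r ->
  input i x = Some s <-> undef_graph r [:: (0, x)] (VInd (2, s)).
Proof.
move=> ir; rewrite (iter_int_undef_graph _ _ _ _ ir); split=> [E|].
  by exists SyInput; [left; left; left|rewrite /= E].
case=> f [[[->|->]|->]|->] //=.
by case: input => //= a [->].
Qed.

(** At tag 2 the value separates the other three: tag 2 for [sigma], tag 1 for [output], a truth
    value for [T]. *)
Lemma sigma_undef_graph i r s s' : iter_is_int i r ->
  sigma i s = Some s' <-> undef_graph r [:: (2, s)] (VInd (2, s')).
Proof.
move=> ir; rewrite (iter_int_undef_graph _ _ _ _ ir); split=> [E|].
  by exists SySigma; [left; left; right|rewrite /= E].
case=> f [[[->|->]|->]|->] //=.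
- by case: sigma => //= a [->].
- by case: ifP.
- by case: output.
Qed.

Lemma output_undef_graph i r s w : iter_is_int i r ->
  output i s = Some w <-> undef_graph r [:: (2, s)] (VInd (1, w)).
Proof.
move=> ir; rewrite (iter_int_undef_graph _ _ _ _ ir); split=> [E|].
  by exists SyOutput; [right|rewrite /= E].
case=> f [[[->|->]|->]|->] //=.
- by case: sigma.
- by case: ifP.
- by case: output => //= a [->].
Qed.

Lemma iT_undef_graph i r s : iter_is_int i r ->
  iT i s <-> undef_graph r [:: (2, s)] (VBoole true).
Proof.
move=> ir; rewrite (iter_int_undef_graph _ _ _ _ ir); split=> [Ts|].
  (* [T] has a value only at states, hence the appeal to [iT_sub]. *)
  by exists SyT; [left; right|rewrite /= !asboolT //; exact: iT_sub].
case=> f [[[->|->]|->]|->] //=.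
- by case: sigma.
- by case: ifP => // _ [/asboolP].
- by case: output.
Qed.

(** The other fields are proofs, equal by proof irrelevance once the data agree. *)
Lemma iterator_ext i i' : iX i = iX i' -> iW i = iW i' -> iS i = iS i' ->
  input i = input i' -> sigma i = sigma i' -> iT i = iT i' ->
  output i = output i' -> i = i'.
Proof.
case: i => X W S f g T h f1 f2 f3 f4; case: i' => X' W' S' f' g' T' h' + + + +.
move=> + + + + /= XX' WW' SS' ff' gg' TT' hh'.
case: X' / XX'; case: W' / WW'; case: S' / SS'; case: f' / ff'; case: g' / gg'.
case: T' / TT'; case: h' / hh' => f1' f2' f3' f4'.
by congr Iterator; exact: Prop_irrelevance.
Qed.

(** Each component is the fibre of the universe over its tag. *)
Lemma iter_universe_inj i i' : iter_universe i = iter_universe i' ->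
  [/\ iX i = iX i', iW i = iW i' & iS i = iS i'].
Proof.
have XE j : iX j = [set u | iter_universe j (0, u)].
  by apply/seteqP; split=> [u Xu|u [[[]|[]]|[]]] //; left; left.
have WE j : iW j = [set u | iter_universe j (1, u)].
  by apply/seteqP; split=> [u Wu|u [[[]|[]]|[]]] //; left; right.
have SE j : iS j = [set u | iter_universe j (2, u)].
  by apply/seteqP; split=> [u Su|u [[[]|[]]|[]]] //; right.
by move=> e; rewrite !XE !WE !SE e.
Qed.

Lemma cart1_inj {V : Type} (A B : set V) : cart A 1 = cart B 1 -> A = B.
Proof.
have cartE (C : set V) : C = [set v | cart C 1 [:: v]].
  apply/seteqP; split=> [v Cv|v [_]]; first by split=> // _ [<-|[]].
  by apply; left.
by move=> e; rewrite (cartE A) (cartE B) e.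
Qed.

End IteratorIntension.

Theorem proposition4p6 (U : Type) (i i' : iterator U)
  (r r' : recursor (seq.seq (nat * U)) (value (nat * U)))
  (hr : iter_is_int i r) (hr' : iter_is_int i' r')
  (hrr' : recursor_eq r r') :
  iX i = iX i' /\ iW i = iW i' /\ i = i'.
Proof.
have graphE y w := recursor_eq_undef_graph r r' y w hrr'.
(* The input sets are the universes, seen as sequences of length one; they yield [X], [W] and
   [S]. *)
have [inE _ _ _] := hrr'.
rewrite (iter_int_input _ _ hr) (iter_int_input _ _ hr') in inE.
have [XX' WW' SS'] := iter_universe_inj _ _ (cart1_inj _ _ inE).
split=> //; split=> //; apply: iterator_ext => //.
- apply: option_ext => x s.
  rewrite (input_undef_graph _ _ _ _ hr) graphE.
  by rewrite -(input_undef_graph _ _ _ _ hr').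
- apply: option_ext => s s'.
  rewrite (sigma_undef_graph _ _ _ _ hr) graphE.
  by rewrite -(sigma_undef_graph _ _ _ _ hr').
- apply/seteqP; split=> s.
    by move/(iT_undef_graph _ _ _ hr)/graphE/(iT_undef_graph _ _ _ hr').
  by move/(iT_undef_graph _ _ _ hr')/graphE/(iT_undef_graph _ _ _ hr).
- apply: option_ext => s w.
  rewrite (output_undef_graph _ _ _ _ hr) graphE.
  by rewrite -(output_undef_graph _ _ _ _ hr').
Qed.
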